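(* Let $M\ge 1$ (the number of participants) and $K\ge 1$ (the number of decoy Bell pairs per participant) be integers. Suppose Eve performs the collective attack in which she applies the same operator $U_E$ on $\mathbb{C}^2\otimes\mathbb{C}^2$ (transmitted qubit $\otimes$ ancillary qubit), with $U_E^\dagger U_E=I$, independently to each qubit sent from Alice to the participants together with a fresh ancillary qubit prepared in a fixed unit vector $|e\rangle\in\mathbb{C}^2$. Then Eve cannot obtain any information about the participants' secret shares without having a nonzero probability of being detected during the eavesdropping check. That is: if the attack $(U_E,|e\rangle)$ yields Eve information about the participants' shares, then the probability that Eve is detected during the eavesdropping check is strictly positive. Equivalently, if the detection probability is $0$, then the attack yields Eve no information about the participants' shares. (The terms ''yields information'' and ''detected'' are defined in the context.)
   Context: Notation. $\{|0\rangle,|1\rangle\}$ is the standard orthonormal basis of $\mathbb{C}^2$ (the $Z$ basis), $|\pm\rangle=\frac{1}{\sqrt2}(|0\rangle\pm|1\rangle)$, and $H$ is the Hadamard operator with $H|0\rangle=|+\rangle$, $H|1\rangle=|-\rangle$. The Bell states are $|\phi^{\pm}\rangle=\frac{1}{\sqrt2}(|00\rangle\pm|11\rangle)$ and $|\psi^{\pm}\rangle=\frac{1}{\sqrt2}(|01\rangle\pm|10\rangle)$. Message states and shares. Alice encodes a bit $k\in\{0,1\}$ in the $M$-qubit state $|\psi_k\rangle=\frac{1}{\sqrt2}\big(|+\rangle^{\otimes M}+(-1)^k|-\rangle^{\otimes M}\big)$ and sends the $i$-th qubit to participant $i$, for $i=1,\dots,M$. Participant $i$ measures it in the $Z$ basis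 and obtains the bit $r_i$, which is that participant's share. Decoys and eavesdropping check. For each participant, Alice prepares $K$ Bell pairs, each chosen independently and uniformly from $\{|\phi^+\rangle,|\phi^-\rangle,|\psi^+\rangle,|\psi^-\rangle\}$. She keeps the first qubit $A$ of each pair and sends the second qubit $B$ to the participant, mixed at random positions among the message qubits. For each decoy qubit the participant chooses at random, each with probability $1/2$ and independently, one of two operations. In the $\mathbf{M}$ operation the qubit is measured directly in the $Z$ basis. In the $\mathbf{MH}$ operation $H$ is applied and the qubit is then measured in the $Z$ basis. Alice performs the same operation on her qubit of that pair. The expected outcomes are as follows. - If both perform $\mathbf{M}$: the two outcomes are equal for $|\phi^+\rangle,|\phi^-\rangle$ and different for $|\psi^+\rangle,|\psi^-\rangle$. - If both perform $\mathbf{MH}$: the two outcomes are equal for $|\phi^+\rangle,|\psi^+\rangle$ and different for $|\phi^-\rangle,|\psi^-\rangle$. Eve is ''detected'' if, for at least one decoy pair, the outcomes of Alice and the participant are not as expected. The attack. Each transmitted qubit, whether decoy or message, is intercepted before it reaches the participant. The operator $U_E$ is applied to (transmitted qubit) $\otimes\,|e\rangle$, with a fresh ancilla for each transmitted qubit. The transmitted qubit is then forwarded, and Eve keeps the ancilla and may measure it later. Thus a decoy Bell state $|\beta\rangle_{AB}$ becomes $(I_A\otimes U_E)(|\beta\rangle_{AB}\otimes|e\rangle)$. A message state $|\psi_k\rangle$ together with $M$ ancillas $|e\rangle^{\otimes M}$ is acted on by one copy of $U_E$ on each (participant qubit, ancilla) pair. Information. For $k\in\{0,1\}$ and an outcome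 string $r=(r_1,\dots,r_M)\in\{0,1\}^M$ that occurs with positive probability when the participants measure their qubits of the attacked message state $|\psi_k\rangle$ in the $Z$ basis, let $\rho_{k,r}$ be the normalized conditional state (density operator) of Eve's $M$ ancillas given that outcome. The attack ''yields Eve no information about the participants' shares'' if $\rho_{k,r}$ is the same density operator for all such pairs $(k,r)$. Otherwise the attack yields information. *)

(* Defs.v *)
From HB Require Import structures.
From mathcomp Require Import all_boot all_order all_algebra.
From mathcomp Require Import spectral.
From mathcomp Require Import reals.
From mathcomp Require Import complex mxtens.

Set Implicit Arguments.
Unset Strict Implicit.
Unset Printing Implicit Defensive.

Import Order.TTheory GRing.Theory Num.Theory.

Local Open Scope ring_scope.
Local Open Scope complex_scope.
Local Open Scope sesquilinear_scope.

Notation bit := 'I_2.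

(* Kets are column vectors and composite systems use the Kronecker product
   A *t B, whose index mxtens_index (i, j) = i * n + j is lexicographic.  Hence
   the three-qubit spaces 2 * 2 * 2 and 2 * (2 * 2) are convertible and both
   index the basis vector |a b c> by 4 * a + 2 * b + c. *)
Section Qubits.
Variable R : realType.
Implicit Types (a b c : bit).

Definition inv_sqrt2 : R[i] := ((Num.sqrt 2)^-1)%:C.

Definition ket b : 'cV[R[i]]_2 := delta_mx b 0.
Definition ket2 a b : 'cV[R[i]]_(2 * 2) := ket a *t ket b.

Definition ket_plus : 'cV[R[i]]_2 := inv_sqrt2 *: (ket 0 + ket 1).
Definition ket_minus : 'cV[R[i]]_2 := inv_sqrt2 *: (ket 0 - ket 1).

Definition hadamard : 'M[R[i]]_2 :=
  \matrix_(i, j) (if j == 0 then ket_plus i 0 else ket_minus i 0).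

End Qubits.

Arguments ket {R}.
Arguments ket2 {R}.

Inductive bell := PhiPlus | PhiMinus | PsiPlus | PsiMinus.

Definition bell_code (beta : bell) : bool * bool :=
  match beta with
  | PhiPlus => (false, false) | PhiMinus => (false, true)
  | PsiPlus => (true, false) | PsiMinus => (true, true)
  end.
Definition bell_decode (c : bool * bool) : bell :=
  match c with
  | (false, false) => PhiPlus | (false, true) => PhiMinus
  | (true, false) => PsiPlus | (true, true) => PsiMinus
  end.
Lemma bell_codeK : cancel bell_code bell_decode. Proof. by case. Qed.
HB.instance Definition _ := Finite.copy bell (can_type bell_codeK).

Inductive decoy_op := OpM | OpMH.

Definition decoy_op_code (o : decoy_op) : bool := if o is OpMH then true else false.
Definition decoy_op_decode (c : bool) : decoy_op := if c then OpMH else OpM.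
Lemma decoy_op_codeK : cancel decoy_op_code decoy_op_decode.
Proof. by case. Qed.
HB.instance Definition _ := Finite.copy decoy_op (can_type decoy_op_codeK).

Section Decoys.
Variable R : realType.
Implicit Types (U : 'M[R[i]]_(2 * 2)) (e : 'cV[R[i]]_2).

Definition bell_state (beta : bell) : 'cV[R[i]]_(2 * 2) :=
  inv_sqrt2 R *: match beta with
                 | PhiPlus => ket2 0 0 + ket2 1 1
                 | PhiMinus => ket2 0 0 - ket2 1 1
                 | PsiPlus => ket2 0 1 + ket2 1 0
                 | PsiMinus => ket2 0 1 - ket2 1 0
                 end.

(* Order of the factors: Alice's qubit A, transmitted qubit B, Eve's ancilla. *)
Definition attacked_decoy U e (beta : bell) : 'cV[R[i]]_(2 * 2 * 2) :=
  (1%:M *t U : 'M_(2 * (2 * 2))) *m (bell_state beta *t e : 'cV_(2 * 2 * 2)).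

Definition premeasured_decoy U e (beta : bell) (o : decoy_op) :
    'cV[R[i]]_(2 * 2 * 2) :=
  match o with
  | OpM => attacked_decoy U e beta
  | OpMH => ((hadamard R *t hadamard R) *t 1%:M : 'M_(2 * 2 * 2))
              *m attacked_decoy U e beta
  end.

(* Born rule for the outcomes (a, b) of Alice and the participant; the ancilla
   is not measured, so its basis index c is summed out. *)
Definition decoy_outcome_prob U e beta o (a b : bit) : R :=
  \sum_(c : bit)
    ComplexField.Normc.normc
      (premeasured_decoy U e beta o (mxtens_index (mxtens_index (a, b), c)) 0)
    ^+ 2.

Definition expected (beta : bell) (o : decoy_op) (a b : bit) : bool :=
  match o, beta with
  | OpM, (PhiPlus | PhiMinus) => a == b
  | OpM, (PsiPlus | PsiMinus) => a != b
  | OpMH, (PhiPlus | PsiPlus) => a == b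
  | OpMH, (PhiMinus | PsiMinus) => a != b
  end.

(* A run of one decoy pair: its Bell state, the operation chosen, and the
   outcomes of Alice and of the participant. *)
Definition decoy_run : finType := (bell * decoy_op * (bit * bit))%type.

Definition run_prob U e (w : decoy_run) : R :=
  let: (beta, o, (a, b)) := w in
  4^-1 * 2^-1 * decoy_outcome_prob U e beta o a b.

Definition unexpected (w : decoy_run) : bool :=
  let: (beta, o, (a, b)) := w in ~~ expected beta o a b.

(* The K decoy pairs of the M participants are indexed by 'I_M * 'I_K; their
   runs are independent, each pair meeting its own copy of U and of e.  The
   positions of the decoys among the message qubits play no role, since U is
   applied to every transmitted qubit. *)
Definition detection_prob (M K : nat) U e : R :=
  \sum_(w : {ffun 'I_M * 'I_K -> decoy_run} | [exists d, unexpected (w d)])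
    \prod_(d : 'I_M * 'I_K) run_prob U e (w d).

End Decoys.

(* A register of M sites of dimension d has the strings {ffun 'I_M -> 'I_d} as
   computational basis, and its states are given by their amplitudes.  The site
   dimension 2 * 2 stands for (transmitted qubit) * (ancilla). *)
Section Message.
Variables (R : realType) (M : nat).
Implicit Types (U : 'M[R[i]]_(2 * 2)) (e : 'cV[R[i]]_2) (k : bit).

Definition str d := {ffun 'I_M -> 'I_d}.
Definition reg d := {ffun str d -> R[i]}.

Definition tensor_power d (v : 'cV[R[i]]_d) : reg d :=
  [ffun x : str d => \prod_i v (x i) 0].

Definition apply_each d (A : 'M[R[i]]_d) (v : reg d) : reg d :=
  [ffun x : str d => \sum_(y : str d) (\prod_i A (x i) (y i)) * v y].

Definition join_str (x y : str 2) : str (2 * 2) :=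
  [ffun i => mxtens_index (x i, y i)].

Definition tensor_sites (v w : reg 2) : reg (2 * 2) :=
  [ffun z : str (2 * 2) => v [ffun i => (mxtens_unindex (z i)).1] *
                           w [ffun i => (mxtens_unindex (z i)).2]].

Definition message_state k : reg 2 :=
  [ffun x => inv_sqrt2 R * (tensor_power (ket_plus R) x +
                            (-1) ^+ k * tensor_power (ket_minus R) x)].

Definition attacked_message U e k : reg (2 * 2) :=
  apply_each U (tensor_sites (message_state k) (tensor_power e)).

(* The unnormalized state of Eve's ancillas after the participants obtain r. *)
Definition eve_vector U e k (r : str 2) : reg 2 :=
  [ffun y => attacked_message U e k (join_str r y)].

Definition shares_prob U e k (r : str 2) : R :=
  \sum_(y : str 2) ComplexField.Normc.normc (eve_vector U e k r y) ^+ 2.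

(* Matrix entries of the conditional density operator; meaningful only when
   shares_prob U e k r > 0. *)
Definition eve_density U e k (r : str 2) : {ffun str 2 * str 2 -> R[i]} :=
  [ffun yz => eve_vector U e k r yz.1 * (eve_vector U e k r yz.2)^* /
              (shares_prob U e k r)%:C].

Definition yields_no_information U e : Prop :=
  forall (k k' : bit) (r r' : str 2),
    0 < shares_prob U e k r -> 0 < shares_prob U e k' r' ->
    eve_density U e k r = eve_density U e k' r'.

Definition yields_information U e : Prop := ~ yields_no_information U e.

End Message.

(* Main.v *)
(* Write U |a>|e> = sum_b |b>|E_ab>.  If Eve is never detected then already the
   decoys in the state |phi+> are decisive: the operation M forces
   E_01 = E_10 = 0, and then MH forces E_00 = E_11.  So U |a>|e> = |a>|E> with
   one and the same E, and the attacked message state is the product of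
   |psi_k> with M copies of E, whose conditional ancilla state depends neither
   on k nor on r. *)
Require Import Defs.
From mathcomp Require Import all_boot all_order all_algebra.
From mathcomp Require Import spectral reals complex mxtens.

Import Order.TTheory GRing.Theory Num.Theory.

Local Open Scope ring_scope.
Local Open Scope complex_scope.
Local Open Scope sesquilinear_scope.

Lemma big_mxtens (V : nmodType) (m n : nat) (F : 'I_(m * n) -> V) :
  \sum_i F i = \sum_a \sum_b F (mxtens_index (a, b)).
Proof.
rewrite pair_big (reindex (@mxtens_index m n)) /=.
  by apply: eq_bigr => -[a b].
by exists (@mxtens_unindex m n) => i _; rewrite (mxtens_indexK, mxtens_unindexK).
Qed.

Lemma tens_colE (S : pzRingType) (m n : nat) (u : 'cV[S]_m) (v : 'cV[S]_n)
    (a : 'I_m) (b : 'I_n) :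
  (u *t v) (mxtens_index (a, b)) (0 : 'I_1) = u a 0 * v b 0.
Proof. by rewrite !mxE mxtens_indexK !ord1. Qed.

Section Attack.
Variable R : realType.
Implicit Types (U : 'M[R[i]]_(2 * 2)) (e : 'cV[R[i]]_2).

(** [U] acts on the factors grouped as A (B E), while the measurements of A and B read them as (A B)
    E. This identity of lexicographic indices passes between the two groupings. *)
Lemma mxtens_index2A (a b c : bit) :
  mxtens_index (a, mxtens_index (b, c)) =
  mxtens_index (mxtens_index (a, b), c) :> 'I_(2 * (2 * 2)).
Proof. by apply: val_inj; rewrite /= mulnDl mulnA addnA. Qed.

Lemma inv_sqrt2_neq0 : inv_sqrt2 R != 0.
Proof.
apply/eqP => -[/eqP]; rewrite invr_eq0 sqrtr_eq0.
by rewrite leNgt ltr0n.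
Qed.

(* The amplitude [<b c| U |a>|e>]. *)
Definition attack_amp U e (a b c : bit) : R[i] :=
  \sum_d U (mxtens_index (b, c)) (mxtens_index (a, d)) * e d 0.

Lemma bell_state_PhiPlusE (a b : bit) :
  bell_state R PhiPlus (mxtens_index (a, b)) 0 = inv_sqrt2 R * (a == b)%:R.
Proof.
rewrite mxE mxE !tens_colE !mxE !eqxx !andbT.
by case: a b => [[|[|//]] ?] [[|[|//]] ?] //=;
  rewrite ?(mulr0, mul0r, mulr1, addr0, add0r).
Qed.

(** In |phi+> the two qubits agree in the Z basis and the attack leaves A untouched, so the
    component with A in |a> is a multiple of U |a>|e>. *)
Lemma attacked_PhiPlusE U e (a b c : bit) :
  attacked_decoy U e PhiPlus (mxtens_index (mxtens_index (a, b), c)) 0 =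
  inv_sqrt2 R * attack_amp U e a b c.
Proof.
rewrite /attacked_decoy -mxtens_index2A mxE big_mxtens (bigD1 a) //=.
rewrite [X in _ + X]big1 ?addr0 => [|x xa]; last first.
  by apply: big1 => y _; rewrite tensmxE mxE eq_sym (negPf xa) mul0r mul0r.
have entryE (x d : bit) : (bell_state R PhiPlus *t e : 'cV_(2 * 2 * 2))
    (mxtens_index (a, mxtens_index (x, d)) : 'I_(2 * (2 * 2))) 0
    = inv_sqrt2 R * (a == x)%:R * e d 0.
  by rewrite mxtens_index2A tens_colE bell_state_PhiPlusE.
rewrite big_mxtens (bigD1 a) //= [X in _ + X]big1 ?addr0 => [|x xa].
  rewrite mulr_sumr; apply: eq_bigr => d _.
  by rewrite entryE eqxx mulr1 tensmxE mxE eqxx mul1r mulrCA.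
by apply: big1 => d _; rewrite entryE eq_sym (negPf xa) mulr0 mul0r mulr0.
Qed.

Lemma hadamardE (a b : bit) :
  hadamard R a b = inv_sqrt2 R * (-1) ^+ (a * b).
Proof.
rewrite !mxE; case: a b => [[|[|//]] ?] [[|[|//]] ?] //=;
  by rewrite ?(subr0, add0r, addr0, sub0r).
Qed.

(** The cube collects one normalization from |phi+> and one from each of the two Hadamard operators,
    whose signs multiply to the character in the sum. *)
Lemma premeasured_MH_PhiPlusE U e (a b c : bit) :
  premeasured_decoy U e PhiPlus OpMH (mxtens_index (mxtens_index (a, b), c)) 0 =
  inv_sqrt2 R ^+ 3 *
  \sum_(x : bit) \sum_(y : bit) (-1) ^+ (a * x + b * y) * attack_amp U e x y c.
Proof.
rewrite /= mxE big_mxtens big_mxtens mulr_sumr; apply: eq_bigr => x _.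
rewrite mulr_sumr; apply: eq_bigr => y _.
rewrite (bigD1 c) //= [X in _ + X]big1 ?addr0 => [|d dc]; last first.
  by rewrite tensmxE [_%:M _ _]mxE eq_sym (negPf dc) mulr0 mul0r.
rewrite !tensmxE [_%:M _ _]mxE eqxx mulr1 attacked_PhiPlusE !hadamardE exprD.
by rewrite [X in X * _ = _]mulrACA [LHS]mulrACA !exprSr expr0 mul1r.
Qed.

Lemma normc_ge0 (z : R[i]) : 0 <= ComplexField.Normc.normc z.
Proof. by case: z => x y; apply: sqrtr_ge0. Qed.

Lemma normc_sqr (z : R[i]) : (ComplexField.Normc.normc z ^+ 2)%:C = z * z^*.
Proof. by rewrite -normCK -rmorphXn. Qed.

Lemma decoy_outcome_prob_ge0 U e beta o a b :
  0 <= decoy_outcome_prob U e beta o a b.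
Proof. by apply: sumr_ge0 => c _; rewrite exprn_ge0 ?normc_ge0. Qed.

Lemma run_prob_ge0 U e w : 0 <= run_prob U e w.
Proof.
by case: w => -[beta o] [a b]; rewrite !mulr_ge0 ?invr_ge0 ?decoy_outcome_prob_ge0.
Qed.

(** It suffices to exhibit one family of runs of positive weight: the constant family at [w] works,
    because its weight is a power of [run_prob U e w]. Positivity of [M] and [K] ensures that some
    pair shows the unexpected outcome. *)
Lemma detection_prob_gt0 (M K : nat) U e (w : decoy_run) :
  (0 < M)%N -> (0 < K)%N -> unexpected w -> 0 < run_prob U e w ->
  0 < detection_prob M K U e.
Proof.
case: M => // M _; case: K => // K _ unexp_w w_gt0.
rewrite /detection_prob (bigD1 [ffun => w]) /=; last first.
  by apply/existsP; exists (0, 0); rewrite ffunE.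
rewrite ltr_pwDl //; first by apply: prodr_gt0 => d _; rewrite ffunE.
by apply: sumr_ge0 => v _; apply: prodr_ge0 => d _; apply: run_prob_ge0.
Qed.

(** An outcome probability is a sum of squared moduli over the ancilla index, so when it vanishes
    every amplitude in it vanishes. *)
Lemma undetected_premeasured_eq0 (M K : nat) U e beta o (a b c : bit) :
  (0 < M)%N -> (0 < K)%N -> ~~ (0 < detection_prob M K U e) ->
  ~~ expected beta o a b ->
  premeasured_decoy U e beta o (mxtens_index (mxtens_index (a, b), c)) 0 = 0.
Proof.
move=> M_gt0 K_gt0 undet unexp.
have prob0 : decoy_outcome_prob U e beta o a b = 0.
  apply/eqP; rewrite eq_le decoy_outcome_prob_ge0 andbT leNgt.
  apply: contra undet => prob_gt0.
  apply: (@detection_prob_gt0 _ _ _ _ (beta, o, (a, b))) => //=.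
  by rewrite !mulr_gt0 ?invr_gt0.
apply: ComplexField.Normc.eq0_normc; apply/eqP.
rewrite -sqrf_eq0; apply/eqP.
by apply: (psumr_eq0P _ prob0) => // d _; rewrite exprn_ge0 ?normc_ge0.
Qed.

Lemma undetected_attack_amp (M K : nat) U e (a b c : bit) :
  (0 < M)%N -> (0 < K)%N -> ~~ (0 < detection_prob M K U e) ->
  attack_amp U e a b c = (a == b)%:R * attack_amp U e 0 0 c.
Proof.
move=> M_gt0 K_gt0 undet.
have off x y : x != y -> attack_amp U e x y c = 0.
  move=> xy; apply: (mulfI inv_sqrt2_neq0).
  rewrite mulr0 -attacked_PhiPlusE.
  exact: (undetected_premeasured_eq0 M K U e PhiPlus OpM).
have diag : attack_amp U e 1 1 c = attack_amp U e 0 0 c.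
  (* For the forbidden outcome (0, 1) the sign is (-1)^y; with the off-diagonal terms gone, what
     remains is E_00 - E_11. *)
  have := undetected_premeasured_eq0 M K U e PhiPlus OpMH 0 1 c
            M_gt0 K_gt0 undet isT.
  rewrite premeasured_MH_PhiPlusE => /eqP.
  rewrite mulf_eq0 expf_eq0 (negPf inv_sqrt2_neq0) andbF /=.
  rewrite !big_ord_recl !big_ord0 (off ord0 (lift ord0 ord0)) //.
  rewrite (off (lift ord0 ord0) ord0) //=.
  rewrite !(mulr0, addr0, add0r) expr0 expr1 mul1r mulN1r subr_eq0 => /eqP ->.
  by congr (attack_amp _ _ _ _ _); apply: val_inj.
have [<-{b}|ab] := eqVneq a b; last by rewrite off // mul0r.
rewrite mul1r; case: a => [[|[|//]] lt_a].
  by congr (attack_amp _ _ _ _ _); apply: val_inj.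
by rewrite -diag; congr (attack_amp _ _ _ _ _); apply: val_inj.
Qed.

Lemma attacked_messageE (M : nat) U e k (r y : str M 2) :
  attacked_message M U e k (join_str r y) =
  \sum_(s : str M 2)
    message_state R M k s * \prod_i attack_amp U e (s i) (r i) (y i).
Proof.
rewrite ffunE.
pose fst_str (z : str M (2 * 2)) : str M 2 := [ffun i => (mxtens_unindex (z i)).1].
pose snd_str (z : str M (2 * 2)) : str M 2 := [ffun i => (mxtens_unindex (z i)).2].
rewrite (reindex (fun p : str M 2 * str M 2 => join_str p.1 p.2)) /=; last first.
  exists (fun z => (fst_str z, snd_str z)) => [[s t] _|z _] /=.
    by congr (_, _); apply/ffunP => i; rewrite !ffunE mxtens_indexK.
  by apply/ffunP => i; rewrite !ffunE -surjective_pairing mxtens_unindexK.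
rewrite -(pair_big xpredT xpredT (fun s t : str M 2 =>
  (\prod_i U (join_str r y i) (join_str s t i)) *
  tensor_sites (message_state R M k) (tensor_power M e) (join_str s t))) /=.
(* The ancillas start in a product state, so the sum over their strings [t] factors into one sum per
   site, each an [attack_amp]. *)
apply: eq_bigr => s _; rewrite /attack_amp bigA_distr_bigA mulr_sumr.
apply: eq_bigr => t _; rewrite ffunE.
have -> : [ffun i => (mxtens_unindex (join_str s t i)).1] = s.
  by apply/ffunP => i; rewrite !ffunE mxtens_indexK.
have -> : [ffun i => (mxtens_unindex (join_str s t i)).2] = t.
  by apply/ffunP => i; rewrite !ffunE mxtens_indexK.
rewrite mulrCA; congr (_ * _); rewrite ffunE -big_split /=.
by apply: eq_bigr => i _; rewrite !ffunE.
Qed.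

(** All dependence on [k] and [r] sits in the scalar [f k r]. It enters both the projector and its
    trace as the squared modulus of [f k r], and so cancels on normalization. *)
Lemma product_yields_no_information (M : nat) U e
    (f : bit -> str M 2 -> R[i]) (g : str M 2 -> R[i]) :
  (forall k r y, eve_vector U e k r y = f k r * g y) ->
  yields_no_information M U e.
Proof.
move=> evE.
pose N := \sum_y ComplexField.Normc.normc (g y) ^+ 2.
have probE k r : shares_prob U e k r = ComplexField.Normc.normc (f k r) ^+ 2 * N.
  rewrite mulr_sumr; apply: eq_bigr => y _.
  by rewrite evE ComplexField.Normc.normcM exprMn.
have densE k r : 0 < shares_prob U e k r ->
    eve_density U e k r = [ffun yz => g yz.1 * (g yz.2)^* / N%:C].
  move=> prob_gt0; apply/ffunP => -[y z]; rewrite [LHS]ffunE [RHS]ffunE /= !evE.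
  have f_neq0 : f k r != 0.
    apply: contraTneq prob_gt0 => f0.
    by rewrite probE f0 ComplexField.Normc.normc0 expr0n mul0r ltxx.
  have -> : (shares_prob U e k r)%:C = f k r * (f k r)^* * N%:C.
    by rewrite probE -normc_sqr -rmorphM.
  rewrite rmorphM [X in X / _]mulrACA invfM [LHS]mulrACA divff ?mul1r //.
  by rewrite mulf_neq0 ?conjC_eq0.
by move=> k k' r r' p_gt0 p'_gt0; rewrite !densE.
Qed.

End Attack.

Theorem theorem1 (R : realType) (M K : nat) (hM : (1 <= M)%N) (hK : (1 <= K)%N)
    (U : 'M[R[i]]_(2 * 2)) (e : 'cV[R[i]]_2)
    (hU : U ^t* *m U = 1%:M) (he : e ^t* *m e = 1%:M) :
  yields_information M U e -> 0 < detection_prob M K U e.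
Proof.
move=> info; apply/negP => /negP undet; apply: info.
(* The scalar is the amplitude of |psi_k> at [r], and the common vector is the tensor power of E =
   E_00. *)
apply: (@product_yields_no_information _ _ _ _ (fun k r => message_state R M k r)
  (fun y => \prod_i attack_amp R U e 0 0 (y i))) => k r y.
rewrite ffunE attacked_messageE (bigD1 r) //= [X in _ + X]big1 ?addr0 => [|s sr].
  congr (_ * _); apply: eq_bigr => i _.
  by rewrite (undetected_attack_amp _ M K) // eqxx mul1r.
(* A string [s] other than [r] differs from it at some site, where the off-diagonal amplitude is
   zero and kills the whole product. *)
have /existsP[i sri] : [exists i, s i != r i].
  apply: contraR sr; rewrite negb_exists => /forallP sr.
  by apply/eqP/ffunP => i; apply/eqP; rewrite -[_ == _]negbK.
rewrite (bigD1 i) //= (undetected_attack_amp _ M K) // (negPf sri).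
by rewrite !mul0r mulr0.
Qed.
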